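(* Let $K$ be a field equipped with a surjective valuation $\nu:K\to\mathbb{T}$ with valuation ring $\mathcal{O}_K$. Let $A$ be a $K$-algebra, $X=\operatorname{Spec} A$ and $Y=\operatorname{Spec}_s\mathbb{S}_{\mathrm{fg}}(A)$. Then there is a canonical homeomorphism $X\cong Y$. Under this homeomorphism, basic open sets $D(f)\subseteq\operatorname{Spec} A$ correspond to basic open sets $D(\langle f\rangle)\subseteq\operatorname{Spec}_s\mathbb{S}_{\mathrm{fg}}(A)$, for $f\in A$.
   Context: $\mathbb{T}=\mathbb{R}\cup\{-\infty\}$ is the tropical semifield (addition $\max$, multiplication the usual addition of reals); $\nu$ is multiplicative, $\nu(x)=-\infty$ iff $x=0$, $\nu(x+y)\le\max(\nu(x),\nu(y))$, and $\mathcal{O}_K=\{x:\nu(x)\le\nu(1)\}$. Algebras are commutative. $\mathbb{S}_{\mathrm{fg}}(A)$ is the semiring of finitely generated $\mathcal{O}_K$-submodules of $A$, where $M+N$ is the submodule generated by $M\cup N$ and $MN$ the submodule generated by all products $xy$ with $x\in M,y\in N$. For $f\in A$, $\langle f\rangle$ is the $\mathcal{O}_K$-submodule generated by $f$. An ideal $I$ of a semiring $S$ is an additive submonoid with $IS\subseteq I$; it is saturated if $x,x+y\in I$ implies $y\in I$. $\operatorname{Spec}_s S$ is the set of saturated prime ideals of $S$ with the subspace topology induced from the Zariski topology on $\operatorname{Spec} S$; for $s\in S$, $D(s)=\{\mathfrak p\in\operatorname{Spec}_s S: s\notin\mathfrak p\}$. *)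

(* Defs.v *)
From HB Require Import structures.
From mathcomp Require Export all_boot all_order all_algebra.
From mathcomp Require Export all_classical reals ereal topology.

Set Implicit Arguments.
Unset Strict Implicit.
Unset Printing Implicit Defensive.

Import Order.TTheory GRing.Theory.

Local Open Scope classical_set_scope.
Local Open Scope ring_scope.

Section Valuation.
Variables (R : realType) (K : fieldType).

(* The tropical semifield as a subset of [\bar R]; its addition is [maxe] and
   its multiplication is the addition of [\bar R]. *)
Definition tropical : set (\bar R) := [set t | t <> +oo%E].

Record valuation := Valuation {
  valuation_fun :> K -> \bar R;
  valuation_tropical : forall x, tropical (valuation_fun x);
  valuationM : forall x y,
    valuation_fun (x * y) = (valuation_fun x + valuation_fun y)%E;
  valuation_eqNy : forall x, valuation_fun x = -oo%E <-> x = 0;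
  valuationD : forall x y,
    (valuation_fun (x + y)%R <= maxe (valuation_fun x) (valuation_fun y))%E
}.

Definition valuation_ring (nu : valuation) : set K :=
  [set a | (nu a <= nu 1%R)%E].

End Valuation.

Arguments tropical R : clear implicits.

Section Spectrum.
Variable S : comPzSemiRingType.
Implicit Types (I : set S).

Definition semiring_ideal I :=
  [/\ I 0, forall x y, I x -> I y -> I (x + y) & forall x s, I x -> I (x * s)].

Definition saturated_ideal I := forall x y, I x -> I (x + y) -> I y.

Definition prime_semiring_ideal I :=
  [/\ semiring_ideal I, ~ I 1 & forall x y, I (x * y) -> I x \/ I y].

Record spec := Spec {
  spec_set :> set S;
  spec_prime : prime_semiring_ideal spec_set
}.

HB.instance Definition _ := gen_eqMixin spec.
HB.instance Definition _ := gen_choiceMixin spec.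

Definition zariski_closed_set (E : set S) : set spec := [set p | E `<=` p].

Definition zariski_open : set_system spec :=
  [set U | exists E, U = ~` zariski_closed_set E].

Lemma zariski_openT : zariski_open setT.
Proof.
exists setT; rewrite eqEsubset; split=> // p _ /(_ 1 I).
by case: (spec_prime p).
Qed.

Lemma zariski_openI : setI_closed zariski_open.
Proof.
move=> _ _ [E ->] [F ->]; exists [set x * y | x in E & y in F].
rewrite -setCU; congr (~` _); rewrite eqEsubset; split=> p.
  have [[_ _ pM] _ _] := spec_prime p.
  case=> Ep _ [x Ex [y Fy <-]]; first by apply: pM; exact: Ep.
  by rewrite mulrC; apply: pM; exact: Ep.
have [_ _ pP] := spec_prime p.
move=> EFp; have [Ep|/existsNP[x /not_implyP[Ex npx]]] := pselect (E `<=` p).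
  by left.
right=> y Fy; have /pP[//|//] : spec_set p (x * y).
by apply: EFp; exists x => //; exists y.
Qed.

Lemma zariski_open_bigU (J : Type) (U : J -> set spec) :
  (forall j, zariski_open (U j)) -> zariski_open (\bigcup_j U j).
Proof.
move=> /choice[E UE]; exists (\bigcup_j E j).
rewrite -[LHS]setCK setC_bigcup; congr (~` _).
rewrite eqEsubset; split=> p.
  by move=> Up x [j _ Ejx]; have := Up j I; rewrite UE setCK; exact.
by move=> Ep j _; rewrite UE setCK => x Ejx; apply: Ep; exists j.
Qed.

HB.instance Definition _ := isOpenTopological.Build spec
  zariski_openT zariski_openI zariski_open_bigU.

Definition basic_open (s : S) : set spec := [set p : spec | ~ spec_set p s].

Definition saturated_primes : set spec := [set p : spec | saturated_ideal p].

(* The topology on a [set_type] is the subspace topology. *)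
Definition spec_s : topologicalType := set_type saturated_primes.

Definition basic_open_s (s : S) : set spec_s :=
  [set q : spec_s | ~ spec_set (set_val q) s].

End Spectrum.

(* On a ring, the semiring notion of ideal is the usual one, so that [spec A]
   is the usual prime spectrum when [A] is a commutative ring. *)
Lemma semiring_idealN (A : comPzRingType) (I : set A) x :
  semiring_ideal I -> I x -> I (- x).
Proof. by case=> _ _ IM Ix; rewrite -mulrN1; exact: IM. Qed.

Section FinitelyGeneratedSubmodules.
Variables (R : realType) (K : fieldType) (nu : valuation R K).
(* A commutative [K]-algebra, possibly zero, is given by its structure
   morphism: the algebra structures of the library exclude the zero ring. *)
Variables (A : comPzRingType) (iota : {rmorphism K -> A}).
Implicit Types (M N G : set A).

Definition submodule M :=
  [/\ M 0, forall x y, M x -> M y -> M (x + y)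
    & forall a x, valuation_ring nu a -> M x -> M (iota a * x)].

Definition submodule_span G : set A := smallest submodule G.

Definition finitely_generated M :=
  exists s : seq A, M = submodule_span [set` s].

Record fgsubmod := FGSubmod {
  fgsubmod_set :> set A;
  fgsubmodP : finitely_generated fgsubmod_set
}.

HB.instance Definition _ := gen_eqMixin fgsubmod.
HB.instance Definition _ := gen_choiceMixin fgsubmod.

Lemma fgsubmod_inj (M N : fgsubmod) : M = N :> set A -> M = N.
Proof.
case: M N => [M MP] [N NP] /= eqMN; case: N / eqMN NP => NP.
by rewrite (Prop_irrelevance MP NP).
Qed.

Lemma submodule_submodule_span G : submodule (submodule_span G).
Proof.
split=> [M [[]]//|x y Gx Gy M /= MG|a x a1 Gx M /= MG].
  by have [[_ MD _] _] := MG; apply: MD; [exact: Gx|exact: Gy].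
by have [[_ _ MZ] _] := MG; apply: MZ => //; exact: Gx.
Qed.

Lemma submodule_spanS G M : submodule M -> G `<=` M -> submodule_span G `<=` M.
Proof. by move=> Msub GM x; apply. Qed.

Lemma sub_submodule_span G : G `<=` submodule_span G.
Proof. exact: sub_gen_smallest. Qed.

Lemma submodule_fgsubmod (M : fgsubmod) : submodule M.
Proof. by case: (fgsubmodP M) => s ->; exact: submodule_submodule_span. Qed.

Lemma submodule_span_id M : submodule M -> submodule_span M = M.
Proof.
move=> Msub; rewrite eqEsubset; split; last exact: sub_submodule_span.
exact: submodule_spanS.
Qed.

Lemma submodule_spanUl G M :
  submodule_span (submodule_span G `|` M) = submodule_span (G `|` M).
Proof.
rewrite eqEsubset; split; apply: submodule_spanS;
  try exact: submodule_submodule_span; rewrite subUset; split.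
- apply: submodule_spanS; first exact: submodule_submodule_span.
  by move=> x Gx; apply: sub_submodule_span; left.
- by move=> x Mx; apply: sub_submodule_span; right.
- by move=> x Gx; apply: sub_submodule_span; left; exact: sub_submodule_span.
- by move=> x Mx; apply: sub_submodule_span; right.
Qed.

Lemma submodule_spanUr G M :
  submodule_span (M `|` submodule_span G) = submodule_span (M `|` G).
Proof. by rewrite setUC submodule_spanUl setUC. Qed.

Definition setmulr M N : set A := [set x * y | x in M & y in N].

Lemma setmulrC M N : setmulr M N = setmulr N M.
Proof.
by rewrite eqEsubset; split=> _ [x Mx [y Ny <-]];
  exists y => //; exists x => //; rewrite mulrC.
Qed.

Lemma setmulrA M N G : setmulr M (setmulr N G) = setmulr (setmulr M N) G.
Proof.
rewrite eqEsubset; split.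
  move=> _ [x Mx [_ [y Ny [z Gz <-]] <-]].
  by exists (x * y); [exists x => //; exists y|exists z => //; rewrite mulrA].
move=> _ [_ [x Mx [y Ny <-]] [z Gz <-]].
by exists x => //; exists (y * z); [exists y => //; exists z|rewrite mulrA].
Qed.

Lemma setmulrUl M N G : setmulr (M `|` N) G = setmulr M G `|` setmulr N G.
Proof.
rewrite eqEsubset; split.
  by move=> _ [x [Mx|Nx] [y Gy <-]]; [left|right]; exists x => //; exists y.
by move=> _ [|] [x Mx [y Gy <-]]; exists x; [left| |right|] => //; exists y.
Qed.

Lemma submodule_spanMl G M :
  submodule_span (setmulr (submodule_span G) M) = submodule_span (setmulr G M).
Proof.
have spM := submodule_submodule_span (setmulr G M).
rewrite eqEsubset; split; apply: submodule_spanS => //;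
  try exact: submodule_submodule_span; last first.
  move=> _ [x Gx [y My <-]]; apply: sub_submodule_span.
  by exists x; [exact: sub_submodule_span|exists y].
move=> _ [x Gx [y My <-]].
suff : submodule_span G `<=` [set z | submodule_span (setmulr G M) (z * y)].
  exact.
have [sp0 spD spZ] := spM.
apply: submodule_spanS => [|z Gz /=]; last first.
  by apply: sub_submodule_span; exists z => //; exists y.
split=> /= [|z t zP tP|a z a1 zP]; first by rewrite mul0r.
  by rewrite mulrDl; exact: spD.
by rewrite -mulrA; exact: spZ.
Qed.

Lemma submodule_spanMr G M :
  submodule_span (setmulr M (submodule_span G)) = submodule_span (setmulr M G).
Proof. by rewrite setmulrC submodule_spanMl setmulrC. Qed.

Lemma fg_add (M N : fgsubmod) : finitely_generated (submodule_span (M `|` N)).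
Proof.
have [[s sM] [t tN]] := (fgsubmodP M, fgsubmodP N).
exists (s ++ t); rewrite sM tN submodule_spanUl submodule_spanUr.
congr submodule_span; rewrite eqEsubset; split=> x /=; rewrite mem_cat.
  by move=> [->|->]; rewrite ?orbT.
by move=> /orP.
Qed.

Lemma fg_mul (M N : fgsubmod) : finitely_generated (submodule_span (setmulr M N)).
Proof.
have [[s sM] [t tN]] := (fgsubmodP M, fgsubmodP N).
exists [seq x * y | x <- s, y <- t].
rewrite sM tN submodule_spanMl submodule_spanMr.
congr submodule_span; rewrite eqEsubset; split=> x /=.
  by move=> [y /= sy [z /= tz <-]]; apply: allpairs_f.
by move=> /allpairsP[[y z] /= [sy tz ->]]; exists y => //; exists z.
Qed.

Lemma fg_cyclic (f : A) : finitely_generated (submodule_span [set f]).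
Proof.
exists [:: f]; congr submodule_span; rewrite eqEsubset.
by split=> x /=; rewrite inE => /eqP.
Qed.

Lemma fg_zero : finitely_generated (submodule_span set0).
Proof.
by exists [::]; congr submodule_span; rewrite eqEsubset; split=> x.
Qed.

Definition fgsubmod_add (M N : fgsubmod) : fgsubmod := FGSubmod (fg_add M N).

Definition fgsubmod_mul (M N : fgsubmod) : fgsubmod := FGSubmod (fg_mul M N).

Definition fgsubmod_cyclic (f : A) : fgsubmod := FGSubmod (fg_cyclic f).

Definition fgsubmod_zero : fgsubmod := FGSubmod fg_zero.

Lemma fgsubmod_addA : associative fgsubmod_add.
Proof.
move=> M N P; apply: fgsubmod_inj => /=.
by rewrite submodule_spanUl submodule_spanUr setUA.
Qed.

Lemma fgsubmod_addC : commutative fgsubmod_add.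
Proof. by move=> M N; apply: fgsubmod_inj; rewrite /= setUC. Qed.

Lemma fgsubmod_add0 : left_id fgsubmod_zero fgsubmod_add.
Proof.
move=> M; apply: fgsubmod_inj; rewrite /= submodule_spanUl set0U.
exact/submodule_span_id/submodule_fgsubmod.
Qed.

Lemma fgsubmod_mulA : associative fgsubmod_mul.
Proof.
move=> M N P; apply: fgsubmod_inj => /=.
by rewrite submodule_spanMl submodule_spanMr setmulrA.
Qed.

Lemma fgsubmod_mulC : commutative fgsubmod_mul.
Proof. by move=> M N; apply: fgsubmod_inj; rewrite /= setmulrC. Qed.

Lemma fgsubmod_mul1 : left_id (fgsubmod_cyclic 1) fgsubmod_mul.
Proof.
move=> M; apply: fgsubmod_inj; rewrite /= submodule_spanMl.
rewrite -[RHS](submodule_span_id (submodule_fgsubmod M)).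
congr submodule_span; rewrite eqEsubset; split=> x.
  by move=> [_ -> [y My <-]]; rewrite mul1r.
by move=> Mx; exists 1 => //; exists x => //; rewrite mul1r.
Qed.

Lemma fgsubmod_mulD : left_distributive fgsubmod_mul fgsubmod_add.
Proof.
move=> M N P; apply: fgsubmod_inj => /=.
by rewrite submodule_spanMl submodule_spanUl submodule_spanUr setmulrUl.
Qed.

Lemma fgsubmod_mul0 : left_zero fgsubmod_zero fgsubmod_mul.
Proof.
move=> M; apply: fgsubmod_inj; rewrite /= submodule_spanMl.
by congr submodule_span; rewrite eqEsubset; split=> x // [].
Qed.

HB.instance Definition _ := GRing.isNmodule.Build fgsubmod
  fgsubmod_addA fgsubmod_addC fgsubmod_add0.

HB.instance Definition _ := GRing.Nmodule_isComPzSemiRing.Build fgsubmod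
  fgsubmod_mulA fgsubmod_mulC fgsubmod_mul1 fgsubmod_mulD fgsubmod_mul0.

End FinitelyGeneratedSubmodules.

Definition homeomorphism (X Y : topologicalType) (phi : X -> Y) :=
  continuous phi /\
  exists psi : Y -> X, [/\ cancel phi psi, cancel psi phi & continuous psi].

(* Main.v *)
(** A prime [p] of [A] corresponds to the set of finitely generated submodules
    contained in [p], and a saturated prime [q] of the semiring of finitely
    generated submodules corresponds to the set of [f] with [<f>] in [q].
    Since [<f + g>] is contained in [<f> + <g>], saturation makes the latter an
    ideal; since a submodule is the sum of the cyclic submodules spanned by its
    generators, a saturated ideal is determined by the cyclic submodules it
    contains. *)

Require Import Defs.

Set Implicit Arguments.
Unset Strict Implicit.
Unset Printing Implicit Defensive.

Import GRing.Theory.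

Local Open Scope classical_set_scope.
Local Open Scope ring_scope.

Section Spec.
Variable S : comPzSemiRingType.
Implicit Types (p q : spec S).

Lemma spec_set_inj p q : spec_set p = spec_set q -> p = q.
Proof.
case: p q => [I Ip] [J Jp] /= eqIJ; case: J / eqIJ Jp => Jp.
by rewrite (Prop_irrelevance Ip Jp).
Qed.

Lemma spec_s_saturated (q : spec_s S) : saturated_ideal (spec_set (set_val q)).
Proof. exact: set_mem (valP q). Qed.

Lemma spec_s_inj (q r : spec_s S) :
  spec_set (set_val q) = spec_set (set_val r) -> q = r.
Proof. by move/spec_set_inj/val_inj. Qed.

(** Traces of Zariski opens, unfolded so that each continuity proof comes down to exhibiting a set
    [E]. *)
Lemma spec_s_openE (U : set (spec_s S)) :
  open U <-> exists E : set S,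
    U = [set q | ~ E `<=` spec_set (set_val q)].
Proof.
split=> [[V [E ->] <-]|[E ->]]; first by exists E.
by exists (~` zariski_closed_set E) => //; exists E.
Qed.

End Spec.

Section SpecFgsubmod.
Variables (R : realType) (K : fieldType) (nu : valuation R K).
Variables (A : comPzRingType) (iota : {rmorphism K -> A}).
Implicit Types (M N : fgsubmod nu iota).

Local Notation span := (submodule_span nu iota).
Local Notation cyclic := (fgsubmod_cyclic nu iota).

Lemma ideal_submodule (I : set A) : semiring_ideal I -> submodule nu iota I.
Proof.
by case=> I0 ID IM; split=> // a x _ Ix; rewrite mulrC; exact: IM.
Qed.

(** Allows inclusion of sums, products and cyclic submodules in an ideal of [A] to be tested on
    generators. *)
Lemma submodule_span_ideal (G I : set A) :
  semiring_ideal I -> span G `<=` I <-> G `<=` I.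
Proof.
move=> Iid; split=> [GI x Gx|GI]; last exact: (submodule_spanS (ideal_submodule Iid)).
by apply: GI; exact: sub_submodule_span.
Qed.

Lemma cyclicM f g : cyclic (f * g) = cyclic f * cyclic g.
Proof.
apply: fgsubmod_inj; rewrite /= submodule_spanMl submodule_spanMr.
congr submodule_span; rewrite eqEsubset; split=> x /=.
  by move=> ->; exists f => //; exists g.
by case=> _ -> [_ -> <-].
Qed.

Lemma cyclic0 : cyclic 0 = 0.
Proof.
have sp0 G : span G 0 by have [] := submodule_submodule_span nu iota G.
apply: fgsubmod_inj; rewrite eqEsubset; split; apply: submodule_spanS => //;
  try exact: submodule_submodule_span.
by move=> _ ->; exact: sp0.
Qed.

Lemma cyclic_sub f M : fgsubmod_set M f -> cyclic f `<=` M.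
Proof.
move=> Mf; apply: submodule_spanS; first exact: submodule_fgsubmod.
by move=> _ ->.
Qed.

Lemma mem_cyclic f : fgsubmod_set (cyclic f) f.
Proof. exact: sub_submodule_span. Qed.

(** Inclusion is the natural order of this idempotent semiring; through this identity, saturation
    becomes closure under smaller submodules. *)
Lemma fgsubmod_addr_idPl M N : N `<=` M -> M + N = M.
Proof.
move=> NM; apply: fgsubmod_inj; rewrite /= ((setUidPl _ _).2 NM).
exact/submodule_span_id/submodule_fgsubmod.
Qed.

Section SaturatedIdeal.
Variable I : set (fgsubmod nu iota).
Hypotheses (Iid : semiring_ideal I) (Isat : saturated_ideal I).

Lemma saturated_ideal_sub M N : I M -> N `<=` M -> I N.
Proof. by move=> IM NM; apply: (Isat IM); rewrite fgsubmod_addr_idPl. Qed.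

Lemma saturated_ideal_cyclicP M : I M <-> forall f, fgsubmod_set M f -> I (cyclic f).
Proof.
split=> [IM f Mf|]; first exact: saturated_ideal_sub IM (cyclic_sub Mf).
have [I0 ID _] := Iid; have [s] := fgsubmodP M.
elim: s M => [|f s IHs] M MsE MI.
  rewrite (_ : M = 0) //; apply: fgsubmod_inj; rewrite MsE.
  by congr submodule_span; rewrite eqEsubset; split=> x.
(* Splitting off the generator [f] leaves the span of [s], to which the induction hypothesis
   applies. *)
pose N : fgsubmod nu iota := FGSubmod (ex_intro _ s erefl).
have MfN : M = cyclic f + N.
  apply: fgsubmod_inj; rewrite MsE /= submodule_spanUl submodule_spanUr.
  congr submodule_span; rewrite eqEsubset.
  split=> x /=; rewrite inE; first by move=> /orP[/eqP|]; [left|right].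
  by move=> [->|->]; rewrite ?eqxx ?orbT.
have subM x : (cyclic f `|` N) x -> fgsubmod_set M x.
  by rewrite MfN; exact: sub_submodule_span.
rewrite MfN; apply: ID; first by apply/MI/subM; left; exact: mem_cyclic.
by apply: IHs => // g Ng; apply/MI/subM; right.
Qed.

End SaturatedIdeal.

Definition submodules_in (I : set A) : set (fgsubmod nu iota) :=
  [set M | M `<=` I].

Lemma submodules_in_prime (I : set A) :
  prime_semiring_ideal I -> prime_semiring_ideal (submodules_in I).
Proof.
case=> Iid I1 IP; have [I0 ID IM] := Iid; split=> [||M N].
- split=> [|M N MI NI|M N MI].
  + by apply/submodule_span_ideal.
  + by apply/submodule_span_ideal; rewrite // subUset.
  + apply/submodule_span_ideal => // _ [x Mx [y _ <-]].
    by apply: IM; exact: MI.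
- by move=> /(_ 1); apply: contra_not I1; apply; exact: mem_cyclic.
- move=> /(submodule_span_ideal _ Iid) MNI.
  (* A single [x] of [M] outside [I] serves against every [y] of [N], and so puts all of [N] in
     [I]. *)
  have [|/existsNP[x /not_implyP[Mx nIx]]] := pselect (M `<=` I); first by left.
  right=> y Ny; have /IP[//|//] : I (x * y).
  by apply: MNI; exists x => //; exists y.
Qed.

Lemma submodules_in_saturated (I : set A) : saturated_ideal (submodules_in I).
Proof.
move=> M N _ MNI x Nx; apply: MNI; apply: sub_submodule_span; right; exact: Nx.
Qed.

Lemma submodules_in_cyclic (I : set A) f :
  semiring_ideal I -> submodules_in I (cyclic f) <-> I f.
Proof.
move=> Iid; split=> [|If]; first by apply; exact: mem_cyclic.
by apply/submodule_span_ideal => // _ ->.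
Qed.

(** [cyclic] preserves products, so primality pulls back directly; it is only subadditive, and
    closure under sums is where saturation enters. *)
Lemma preimage_cyclic_prime (I : set (fgsubmod nu iota)) :
  prime_semiring_ideal I -> saturated_ideal I ->
  prime_semiring_ideal (cyclic @^-1` I).
Proof.
move=> [Iid I1 IP] Isat; have [I0 ID IM] := Iid; split=> //= [|f g].
  split=> [|f g If Ig|f g If] /=; first by rewrite cyclic0.
    apply: (saturated_ideal_sub Isat (ID _ _ If Ig)); apply: cyclic_sub.
    have [_ spD _] := submodule_fgsubmod (cyclic f + cyclic g).
    by apply: spD; apply: sub_submodule_span; [left|right]; exact: mem_cyclic.
  by rewrite cyclicM; exact: IM.
by rewrite cyclicM => /IP.
Qed.

Definition spec_to_submodules (p : spec A) : spec_s (fgsubmod nu iota) :=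
  SigSub (mem_set (submodules_in_saturated (I := p)
    : saturated_primes (Spec (submodules_in_prime (spec_prime p))))).

Definition submodules_to_spec (q : spec_s (fgsubmod nu iota)) : spec A :=
  Spec (preimage_cyclic_prime (spec_prime (set_val q)) (@spec_s_saturated _ q)).

Lemma spec_to_submodules_cyclic (p : spec A) f :
  spec_set (set_val (spec_to_submodules p)) (cyclic f) <-> spec_set p f.
Proof. by apply: submodules_in_cyclic; have [] := spec_prime p. Qed.

Lemma spec_to_submodulesK : cancel spec_to_submodules submodules_to_spec.
Proof.
move=> p; apply: spec_set_inj; apply/funext => f; apply/propext.
exact: spec_to_submodules_cyclic.
Qed.

Lemma submodules_to_specK : cancel submodules_to_spec spec_to_submodules.
Proof.
move=> q; apply: spec_s_inj; apply/funext => M; apply/propext.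
have [qid _ _] := spec_prime (set_val q).
exact: iff_sym (saturated_ideal_cyclicP qid (@spec_s_saturated _ q) M).
Qed.

Lemma continuous_spec_to_submodules : continuous spec_to_submodules.
Proof.
apply/continuousP => _ /spec_s_openE[E ->].
(* A prime of [A] contains every member of [E] exactly when it contains their union. *)
exists (\bigcup_(M in E) M); rewrite eqEsubset; split=> p /=; apply: contra_not.
  by move=> Ep M EM f Mf; apply: Ep; exists M.
by move=> Ep f [M EM Mf]; exact: (Ep M EM).
Qed.

Lemma continuous_submodules_to_spec : continuous submodules_to_spec.
Proof.
(* [E] lies in the preimage of [q] under [cyclic] exactly when its image lies in [q]. *)
apply/continuousP => _ [E ->]; apply/spec_s_openE; exists (cyclic @` E).
by rewrite eqEsubset; split=> q /=; apply: contra_not;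
  rewrite /zariski_closed_set /= image_subP.
Qed.

Lemma homeomorphism_spec_to_submodules : homeomorphism spec_to_submodules.
Proof.
split; first exact: continuous_spec_to_submodules.
exists submodules_to_spec; split.
- exact: spec_to_submodulesK.
- exact: submodules_to_specK.
- exact: continuous_submodules_to_spec.
Qed.

Lemma spec_to_submodules_basic_open f :
  spec_to_submodules @` basic_open f = basic_open_s (cyclic f).
Proof.
rewrite eqEsubset; split=> [_ [p pf <-]|q qf].
  by move=> /spec_to_submodules_cyclic.
by exists (submodules_to_spec q); last exact: submodules_to_specK.
Qed.

(** This makes the homeomorphism canonical: by injectivity, the images of the basic open sets decide
    which cyclic submodules belong to [phi p]. *)
Lemma spec_to_submodules_unique (phi : spec A -> spec_s (fgsubmod nu iota)) :
  injective phi ->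
  (forall f, phi @` basic_open f = basic_open_s (cyclic f)) ->
  phi = spec_to_submodules.
Proof.
move=> phi_inj phiD; apply/funext => p.
(* Since [submodules_to_spec] is injective, it suffices to compare primes of [A], element by
   element. *)
apply: (can_inj submodules_to_specK); rewrite spec_to_submodulesK.
apply: spec_set_inj; apply/funext => f; apply/propext.
suff : basic_open_s (cyclic f) (phi p) <-> basic_open f p.
  by move=> [h h']; split=> ?; apply: contrapT => n; [exact: h' n _|exact: h n _].
by rewrite -phiD; split=> [[r rf /phi_inj <-]|]; last exists p.
Qed.

End SpecFgsubmod.

Theorem theorem7p6 (R : realType) (K : fieldType) (nu : valuation R K)
    (nu_surj : set_surj [set: K] (tropical R) nu)
    (A : comPzRingType) (iota : {rmorphism K -> A}) :
  exists! phi : spec A -> spec_s (fgsubmod nu iota),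
    homeomorphism phi /\
    forall f : A, phi @` basic_open f = basic_open_s (fgsubmod_cyclic nu iota f).
Proof.
exists (@spec_to_submodules R K nu A iota); split.
  split; first exact: homeomorphism_spec_to_submodules.
  exact: spec_to_submodules_basic_open.
move=> phi [[_ [psi [phiK _ _]]] phiD]; apply/esym.
exact: spec_to_submodules_unique (can_inj phiK) phiD.
Qed.
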